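(* Suppose $a,b\in\ell^\infty(\mathbb{Z})$ are complex-valued sequences with $a(n)\ne0$ for all $n\in\mathbb{Z}$ and $$\{a(n)^2-\tfrac14\}_{n\in\mathbb{Z}},\ \{b(n)\}_{n\in\mathbb{Z}}\in\ell^1(\mathbb{Z}).$$ Let $p\in\mathbb{N}_{-1}$ and define $$\widehat I_p=\frac1{p+2}\sum_{n\in\mathbb{Z}}\big(\hat f_{p+2}(n)-\lambda_{p+2}\big),\qquad \lambda_{p+2}=\lim_{|n|\to\infty}\hat f_{p+2}(n).$$ Then $$(\nabla\widehat I_p)_a=\frac1{p+2}\frac{\delta\hat f_{p+2}}{\delta a}=-\frac1a\,\hat g_{p+1},\qquad(\nabla\widehat I_p)_b=\frac1{p+2}\frac{\delta\hat f_{p+2}}{\delta b}=\hat f_{p+1}.$$ Moreover, the homogeneous $p$th Toda equations, i.e. the system $a_{t_p}-a(\hat f_{p+1}^+-\hat f_{p+1})=0$, $b_{t_p}+\hat g_{p+1}-\hat g_{p+1}^-=0$, take on the form $$\begin{pmatrix}a_{t_p}\\ b_{t_p}\end{pmatrix}-D\begin{pmatrix}(\nabla\widehat I_p)_a\\ (\nabla\widehat I_p)_b\end{pmatrix}=0,\qquad p\in\mathbb{N}_{-1}.$$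
   Context: $\mathbb{N}=\{1,2,\dots\}$, $\mathbb{N}_0=\mathbb{N}\cup\{0\}$, $\mathbb{N}_{-1}=\mathbb{N}\cup\{0,-1\}$. For a sequence $c$ on $\mathbb{Z}$, $(S^{\pm}c)(n)=c^{\pm}(n)=c(n\pm1)$, and for $s\in\mathbb{Z}$, $(S^{(s)}c)(n)=c^{(s)}(n)=c(n+s)$. Let $L=aS^++a^-S^-+b$. The homogeneous Toda coefficients are $$\hat f_\ell(n)=(\delta_n,L^\ell\delta_n)_{\ell^2(\mathbb{Z})},\qquad \hat g_\ell(n)=-2a(n)(\delta_{n+1},L^\ell\delta_n)_{\ell^2(\mathbb{Z})},\qquad\ell\in\mathbb{N}_0,$$ where $\delta_n$ is the standard basis of $\ell^2(\mathbb{Z})$. Each $\hat f_\ell$ is a fixed ($n$-independent) polynomial in $a,b$ and finitely many of their shifts, in which $a$ and its shifts enter only in even powers. Under the stated hypotheses the limit $\lambda_\ell=\lim_{|n|\to\infty}\hat f_\ell(n)$ exists and $\{\hat f_\ell(n)-\lambda_\ell\}_{n\in\mathbb{Z}}\in\ell^1(\mathbb{Z})$. Variational derivative and gradient: if $F$ is a polynomial of $a,b$ and the shifts $a^{(\pm1)},b^{(\pm1)},\dots,a^{(\pm k)},b^{(\pm k)}$, regarded as independent variables, then for $u\in\{a,b\}$ $$\frac{\delta F}{\delta u}=\sum_{s=-k}^{k}S^{(-s)}\frac{\partial F}{\partial u^{(s)}}.$$ For a functional $\mathcal{F}(a,b)=\sum_{n\in\mathbb{Z}}F(n)$ with density $F$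 of this type (up to an additive constant making the series converge), its gradient is $(\nabla\mathcal{F})_a=\delta F/\delta a$, $(\nabla\mathcal{F})_b=\delta F/\delta b$. $D$ is the matrix difference expression $$D=\begin{pmatrix} 0 & D_1 \\ D_2 & 0 \end{pmatrix},\qquad D_1=aS^+-a,\quad D_2=a-a^-S^-.$$ Time-dependent equations (with $a,b$ depending also on the time $t_p$) are understood locally in time, i.e. on some open $t_p$-interval. *)

(* Defs.v *)
From HB Require Import structures.
From mathcomp Require Import all_boot all_order all_algebra.
From mathcomp Require Import all_classical all_reals all_analysis.
From mathcomp Require Import complex.
(* mpoly's notations clash with those of all_analysis *)
From mathcomp Require Import -(notations) mpoly.
From mathcomp Require Import zify.
Set Implicit Arguments.
Unset Strict Implicit.
Unset Printing Implicit Defensive.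
Import Order.TTheory GRing.Theory Num.Theory numFieldNormedType.Exports.
Local Open Scope classical_set_scope.
Local Open Scope ring_scope.

(* R[i] packed as a numClosedFieldType, so that it carries its norm topology. *)
Definition Cx (R : realType) : numClosedFieldType := R[i].

Definition shiftZ (T : Type) (s : int) (c : int -> T) : int -> T :=
  fun n => c (n + s).

(* The difference expression a S^+ + a^- S^- + b, over any commutative ring:
   it is used over the complex numbers and over a ring of polynomials. *)
Definition jacobi (A : comNzRingType) (a b u : int -> A) : int -> A :=
  fun n => a n * shiftZ 1 u n + shiftZ (-1) a n * shiftZ (-1) u n + b n * u n.

Definition delta (A : comNzRingType) (m : int) : int -> A :=
  fun n => (n == m)%:R.

Section Sequences.
Variable R : realType.
Local Notation C := (Cx R).
Implicit Types (a b u v : int -> C).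

Definition bounded_seqZ u : Prop := exists M : C, forall n, `|u n| <= M.

Definition ell1 u : Prop :=
  summable [set: int] (fun n => (ComplexField.Normc.normc (u n))%:E).

(* Sum of the two one-sided series, over n >= 0 and over n < 0
   (Negz k is the integer -(k+1)). *)
Definition sumZ u : C :=
  limn (series (fun k : nat => u (Posz k))) +
  limn (series (fun k : nat => u (Negz k))).

Definition inftyZ : set_system int :=
  [set P | exists N : nat, forall n : int, (N <= `|n|)%N -> P n].

Global Instance inftyZ_proper : ProperFilter inftyZ.
Proof.
split; first by case=> N /(_ N%:Z); apply.
split.
- by exists 0%N.
- move=> P Q [N HN] [M HM]; exists (maxn N M) => n.
  by rewrite geq_max => /andP[Nn Mn]; split; [exact: HN | exact: HM].
- by move=> P Q PQ [N HN]; exists N => n /HN /PQ.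
Qed.

Definition innerZ u v : C := sumZ (fun n => (u n)^* * v n).

Definition fhat a b (l : nat) : int -> C :=
  fun n => innerZ (delta C n) (iter l (jacobi a b) (delta C n)).

Definition ghat a b (l : nat) : int -> C :=
  fun n => - 2 * a n *
    innerZ (delta C (n + 1)) (iter l (jacobi a b) (delta C n)).

Definition lambda a b (l : nat) : C := lim (fhat a b l @ inftyZ).

Definition toda_data a b : Prop :=
  [/\ bounded_seqZ a, bounded_seqZ b, (forall n, a n != 0),
      ell1 (fun n => a n ^+ 2 - 4^-1) & ell1 b].

Definition Ihat (p : int) a b : C :=
  (p + 2)%:~R^-1 *
  sumZ (fun n => fhat a b `|p + 2| n - lambda a b `|p + 2|).

End Sequences.

(* Polynomials in a^(s), b^(s), -k <= s <= k: the first 2k+1 variables are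
   a^(-k), ..., a^(k), the last 2k+1 are b^(-k), ..., b^(k). *)
Section DifferencePolynomials.
Variable R : realType.
Local Notation C := (Cx R).
Implicit Types (a b : int -> C).

Definition dpoly (k : nat) := mpoly (k.*2.+1 + k.*2.+1) C.

Definition offset (k : nat) (i : 'I_k.*2.+1) : int := i%:Z - k%:Z.

Definition avar k (i : 'I_k.*2.+1) : 'I_(k.*2.+1 + k.*2.+1) :=
  lshift k.*2.+1 i.
Definition bvar k (i : 'I_k.*2.+1) : 'I_(k.*2.+1 + k.*2.+1) :=
  rshift k.*2.+1 i.

Definition jet k a b (n : int) : 'I_(k.*2.+1 + k.*2.+1) -> C :=
  fun j => match fintype.split j with
           | inl i => shiftZ (offset i) a n
           | inr i => shiftZ (offset i) b n
           end.

Definition dpeval k (F : dpoly k) a b : int -> C :=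
  fun n => meval (@jet k a b n) F.

Definition vard_a k (F : dpoly k) a b : int -> C :=
  fun n => \sum_(i < k.*2.+1)
    shiftZ (- offset i) (dpeval (mderiv (avar i) F) a b) n.

Definition vard_b k (F : dpoly k) a b : int -> C :=
  fun n => \sum_(i < k.*2.+1)
    shiftZ (- offset i) (dpeval (mderiv (bvar i) F) a b) n.

(* The coefficient fhat_l as a polynomial: the (0, 0) matrix entry of L^l,
   where the coefficients of L are the variables a^(s), b^(s), |s| <= l (and 0
   for |s| > l: these coefficients do not enter in that matrix entry). *)
Definition gen_a k (s : int) : dpoly k :=
  \sum_(i < k.*2.+1 | offset i == s) mpolyX C (mnm1 (avar i)).
Definition gen_b k (s : int) : dpoly k :=
  \sum_(i < k.*2.+1 | offset i == s) mpolyX C (mnm1 (bvar i)).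

Definition fpoly (l : nat) : dpoly l :=
  iter l (jacobi (gen_a l) (gen_b l)) (delta (dpoly l) 0) 0.

(* The density is a polynomial up to an additive constant c, which does not
   depend on n, a or b and makes the series converge. *)
Definition has_density k (I : (int -> C) -> (int -> C) -> C) (F : dpoly k) :=
  exists c : C, forall a b, toda_data a b ->
    ell1 (fun n => dpeval F a b n - c) /\
    I a b = sumZ (fun n => dpeval F a b n - c).

Definition is_gradient (I : (int -> C) -> (int -> C) -> C)
    (G : (int -> C) -> (int -> C) -> (int -> C) * (int -> C)) : Prop :=
  exists k (F : dpoly k), has_density I F /\
    forall a b, G a b = (vard_a F a b, vard_b F a b).

(* A density is only determined by its functional up to total differences; its
   variational derivatives at toda_data do not depend on that choice. *)
Definition nabla (I : (int -> C) -> (int -> C) -> C) :=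
  xget (fun _ _ => (0, 0)) [set G | is_gradient I G].

End DifferencePolynomials.

Section Toda.
Variable R : realType.
Local Notation C := (Cx R).

Definition diffquot (f : R -> C) (t : R) : R -> C :=
  fun h => (f (t + h) - f t) / real_complex R h.

Definition time_derivable (f : R -> C) (t : R) : Prop :=
  cvg (diffquot f t @ 0^').

Definition time_derivative (f : R -> C) (t : R) : C :=
  lim (diffquot f t @ 0^').

Definition D1 (a u : int -> C) : int -> C :=
  fun n => a n * shiftZ 1 u n - a n * u n.
Definition D2 (a u : int -> C) : int -> C :=
  fun n => a n * u n - shiftZ (-1) a n * shiftZ (-1) u n.

(* The matrix ((0, D1), (D2, 0)) applied to the column (u, v). *)
Definition Dmx (a : int -> C) (uv : (int -> C) * (int -> C)) :
    (int -> C) * (int -> C) := (D1 a uv.2, D2 a uv.1).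

Definition toda_eqs (p : int) (a b : R -> int -> C) (t : R) : Prop :=
  let f := fhat (a t) (b t) `|p + 1| in
  let g := ghat (a t) (b t) `|p + 1| in
  forall n : int,
    time_derivative (a ^~ n) t - a t n * (shiftZ 1 f n - f n) = 0 /\
    time_derivative (b ^~ n) t + g n - shiftZ (-1) g n = 0.

Definition toda_hamiltonian_eqs (p : int) (a b : R -> int -> C) (t : R) : Prop :=
  (fun n => time_derivative (a ^~ n) t, fun n => time_derivative (b ^~ n) t)
  - Dmx (a t) (nabla (Ihat p) (a t) (b t)) = 0.

End Toda.

Section Facts.
Variable R : realType.
Local Notation C := (Cx R).
Implicit Types (a b u : int -> C).

Lemma limn_series_nat_delta (u : nat -> C) (m : nat) :
  (forall k, k != m -> u k = 0) -> limn (series u) = u m.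
Proof.
move=> u0; apply: cvg_lim; first exact: norm_hausdorff.
apply: cvg_near_cst; exists m.+1 => // N /= mN.
rewrite seriesEnat /= (bigD1_seq m) /= ?mem_index_iota ?iota_uniq //=.
by rewrite big1 ?addr0 // => k; exact: u0.
Qed.

Lemma innerZ_delta (m : int) u : innerZ (delta C m) u = u m.
Proof.
have lim0 (v : nat -> C) : (forall k, v k = 0) -> limn (series v) = 0.
  by move=> v0; rewrite (limn_series_nat_delta (m := 0%N)) ?v0.
rewrite /innerZ /sumZ /delta; case: m => m.
  rewrite (limn_series_nat_delta (m := m)) => [|k km]; last first.
    by rewrite (_ : (Posz k == Posz m) = false) ?rmorph0 ?mul0r //; apply/negP; lia.
  by rewrite lim0 ?eqxx ?rmorph1 ?mul1r ?addr0 // => k; rewrite rmorph0 mul0r.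
rewrite addrC (limn_series_nat_delta (m := m)) => [|k km]; last first.
  by rewrite (_ : (Negz k == Negz m) = false) ?rmorph0 ?mul0r //; apply/negP; lia.
by rewrite lim0 ?eqxx ?rmorph1 ?mul1r ?addr0 // => k; rewrite rmorph0 mul0r.
Qed.

Lemma jacobi_supp a b (n : int) (j : nat) (s : int) :
  (j < `|s|)%N -> iter j (jacobi a b) (delta C n) (n + s) = 0.
Proof.
elim: j s => [|j IH] s js.
  by rewrite /= /delta (_ : (n + s == n) = false) //; apply/negP; lia.
rewrite iterS /jacobi /shiftZ -!addrA !IH ?mulr0 ?addr0 //; lia.
Qed.

Lemma jet_avar k a b n i : @jet R k a b n (avar i) = shiftZ (offset i) a n.
Proof. by rewrite /jet /avar (unsplitK (inl i)). Qed.

Lemma jet_bvar k a b n i : @jet R k a b n (bvar i) = shiftZ (offset i) b n.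
Proof. by rewrite /jet /bvar (unsplitK (inr i)). Qed.

Lemma dpeval_gen_a k a b n s :
  meval (@jet R k a b n) (gen_a R k s) = if (`|s| <= k)%N then a (n + s) else 0.
Proof.
rewrite /gen_a raddf_sum /=; case: ifP => sk.
  have lt : (`|(s + k%:Z)%R| < k.*2.+1)%N by lia.
  have off : offset (Ordinal lt) = s by rewrite /offset /=; lia.
  rewrite (big_pred1 (Ordinal lt)) => [|i].
    by rewrite mevalXU jet_avar /shiftZ off.
  rewrite /= -[in RHS]val_eqE /= -[in LHS]off /offset /=.
  by apply/eqP/eqP; lia.
rewrite big1 // => i /eqP; rewrite /offset => ei.
by have := ltn_ord i; lia.
Qed.

Lemma dpeval_gen_b k a b n s :
  meval (@jet R k a b n) (gen_b R k s) = if (`|s| <= k)%N then b (n + s) else 0.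
Proof.
rewrite /gen_b raddf_sum /=; case: ifP => sk.
  have lt : (`|(s + k%:Z)%R| < k.*2.+1)%N by lia.
  have off : offset (Ordinal lt) = s by rewrite /offset /=; lia.
  rewrite (big_pred1 (Ordinal lt)) => [|i].
    by rewrite mevalXU jet_bvar /shiftZ off.
  rewrite /= -[in RHS]val_eqE /= -[in LHS]off /offset /=.
  by apply/eqP/eqP; lia.
rewrite big1 // => i /eqP; rewrite /offset => ei.
by have := ltn_ord i; lia.
Qed.

Lemma fpolyE (l : nat) a b : dpeval (fpoly R l) a b = fhat a b l.
Proof.
apply/funext => n; rewrite /fhat innerZ_delta /dpeval /fpoly.
suff H j s : (j <= l)%N ->
    meval (@jet R l a b n)
      (iter j (jacobi (gen_a R l) (gen_b R l)) (delta (dpoly R l) 0) s) =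
    iter j (jacobi a b) (delta C n) (n + s).
  by rewrite H // addr0.
elim: j s => [|j IH] s jl.
  by rewrite /= /delta rmorph_nat; congr (_%:R); congr nat_of_bool; lia.
rewrite !iterS /jacobi /shiftZ !rmorphD !rmorphM /= !IH ?(ltnW jl) //.
rewrite !dpeval_gen_a !dpeval_gen_b -!addrA.
congr (_ + (_ + _)); case: ifP => // sl;
  by rewrite jacobi_supp ?mulr0 //; lia.
Qed.

End Facts.

(* Main.v *)
(* The diagonal entries of L^l do not change when L is conjugated to
   a^2 S^+ + S^- + b, whose coefficients differ summably from 1/4, 1 and 0. An
   induction on l then shows that fhat_l differs summably from its value at
   a^2 = 1/4, b = 0; in particular lambda_l does not depend on a and b.
   Formally, the sum of the fhat_l(n) is the trace of L^l, so that its derivative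
   along a variation dL is l tr(L^(l-1) dL); for the rank one or two dL coming
   from b(m) or a(m) this is l L^(l-1)(m, m) or 2 l L^(l-1)(m+1, m). Only finitely
   many fhat_l(n) depend on a given a(m) or b(m), so the trace is a finite sum.
   The gradient does not depend on the density: a change of a or b at one site
   changes the functional by a polynomial in the size of the change, whose linear
   coefficient is the variational derivative of any density. *)

Require Import Defs.
From HB Require Import structures.
From mathcomp Require Import all_boot all_order all_algebra.
From mathcomp Require Import all_classical all_reals all_analysis.
From mathcomp Require Import complex.
From mathcomp Require Import -(notations) mpoly.
From mathcomp Require Import zify ring.
Import Order.TTheory GRing.Theory Num.Theory numFieldNormedType.Exports.
Local Open Scope classical_set_scope.
Local Open Scope ring_scope.
Set Implicit Arguments.
Unset Strict Implicit.
Unset Printing Implicit Defensive.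

(** * Summable sequences on the integers *)

Section Ell1.
Variable R : realType.
Local Notation C := (Cx R).
Local Notation normc := ComplexField.Normc.normc.
Implicit Types (u v w : int -> C).

Lemma normcE_norm (x : C) : `|x| = real_complex R (normc x).
Proof. by case: x. Qed.

Lemma normc_ge0 (x : C) : 0 <= normc x.
Proof. by case: x => x y; exact: sqrtr_ge0. Qed.

(** Trades the extended-real sum behind [summable] for bounds on finite sums over duplicate-free
    lists, so that the closure properties below become termwise inequalities. *)
Lemma ell1P u : ell1 u <-> exists M : R, forall s : seq int, uniq s ->
  \sum_(i <- s) normc (u i) <= M.
Proof.
have n0 i : ((0 : R)%:E <= `|(normc (u i))%:E|)%E by exact: abse_ge0.
rewrite /ell1 /summable; split => [fin|[M uM]].
  exists (fine (\esum_(i in [set: int]) `|(normc (u i))%:E|)%E) => s us.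
  rewrite -lee_fin fineK; last first.
    by rewrite ge0_fin_numE //; apply: esum_ge0 => i _; exact: n0.
  apply: esum_ge; exists [set` s]; first by split; [exact: finite_seq|].
  rewrite -fsbig_seq // -sumEFin; apply: lee_sum => i _.
  by rewrite gee0_abs ?lee_fin ?normc_ge0.
apply: (@le_lt_trans _ _ M%:E); last exact: ltry.
apply: ge_ereal_sup => _ /= [F [finF _] <-].
rewrite fsbig_finite //= (eq_bigr (fun i => (normc (u i))%:E)); last first.
  by move=> i _ /=; rewrite ger0_norm ?normc_ge0.
by rewrite sumEFin lee_fin; apply: uM; exact: finmap.fset_uniq.
Qed.

Lemma ell1D u v : ell1 u -> ell1 v -> ell1 (fun n => u n + v n).
Proof.
move=> /ell1P[M uM] /ell1P[N vN]; apply/ell1P; exists (M + N) => s us.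
apply: le_trans (lerD (uM _ us) (vN _ us)); rewrite -big_split /=.
apply: ler_sum => i _.
by rewrite -lecR rmorphD /= -!normcE_norm; exact: ler_normD.
Qed.

Lemma ell1_bounded u : ell1 u -> exists M : R, forall n, normc (u n) <= M.
Proof.
by move=> /ell1P[M uM]; exists M => n; have := uM [:: n]; rewrite big_seq1; apply.
Qed.

Lemma ell1M u v (M : R) : (forall n, normc (u n) <= M) -> ell1 v ->
  ell1 (fun n => u n * v n).
Proof.
move=> uM /ell1P[N vN]; apply/ell1P; exists (M * N) => s us.
have M0 : 0 <= M by apply: le_trans (uM 0); exact: normc_ge0.
apply: le_trans (ler_wpM2l M0 (vN _ us)); rewrite big_distrr /=.
apply: ler_sum => i _; rewrite ComplexField.Normc.normcM.
by apply: ler_wpM2r => //; exact: normc_ge0.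
Qed.

Lemma ell1Z (c : C) u : ell1 u -> ell1 (fun n => c * u n).
Proof. exact: (@ell1M (fun=> c) u (normc c)). Qed.

Lemma ell1_shift s u : ell1 u -> ell1 (shiftZ s u).
Proof.
move=> /ell1P[M uM]; apply/ell1P; exists M => r ur.
rewrite /shiftZ -(big_map (fun i => i + s) predT (fun i => normc (u i))).
by apply: uM; rewrite map_inj_uniq //; exact: addIr.
Qed.

Lemma ell1_delta m : ell1 (delta C m).
Proof.
apply/ell1P; exists 1 => s us.
have [ms|ms] := boolP (m \in s).
  rewrite (bigD1_seq m) //= /delta eqxx big1; last first.
    by move=> i /negbTE->; exact: ComplexField.Normc.normc0.
  by rewrite addr0 ComplexField.Normc.normc1.
rewrite big1_seq ?ler01 // => i /andP[_ si].
rewrite /delta (_ : (i == m) = false) ?ComplexField.Normc.normc0 //.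
by apply: contraNF ms => /eqP<-.
Qed.

Lemma cvgn_real_complex (x : nat -> R) :
  cvgn x -> cvgn (fun n => real_complex R (x n) : C).
Proof.
move=> /cvg_ex[l xl]; apply/cvg_ex; exists (real_complex R l : C).
apply/cvgrPdist_lt => e e0.
(* A positive element of [C] is real, so the estimate can be carried out in [R]. *)
have eE : e = real_complex R (complex.Re e) by rewrite RRe_real // gtr0_real.
have e0' : 0 < complex.Re e.
  by move: e0; rewrite {1}eE -(rmorph0 (real_complex R)) ltcR.
move/cvgrPdist_lt : xl => /(_ _ e0'); apply: filterS => n.
rewrite -rmorphB /= eE normcE_norm ltcR => h.
by rewrite -[normc _]/(Num.sqrt _) /= expr0n /= addr0 sqrtr_sqr.
Qed.

Lemma cvgn_series_real (x : nat -> R) (M : R) :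
  (forall n, \sum_(0 <= k < n) `|x k| <= M) -> cvgn (series x).
Proof.
move=> xM; apply: normed_cvg; apply: nondecreasing_is_cvgn.
  move=> n m nm; rewrite /= !seriesEnat /=.
  by rewrite [leRHS](big_cat_nat (n := n)) //= lerDl sumr_ge0.
by exists M => _ [n _ <-] /=; rewrite seriesEnat; exact: xM.
Qed.

(** The real and imaginary parts are dominated by the modulus, so both real series converge, and
    their limits recombine via ['i]. *)
Lemma cvgn_series_complex (x : nat -> C) (M : R) :
  (forall n, \sum_(0 <= k < n) normc (x k) <= M) -> cvgn (series x).
Proof.
move=> xM; pose re k : R := complex.Re (x k); pose im k : R := complex.Im (x k).
have reM : cvgn (series re).
  refine (@cvgn_series_real _ M _) => n; apply: le_trans (xM n).
  apply: ler_sum => k _; rewrite /re /im; case: (x k) => s t /=.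
  by rewrite -sqrtr_sqr ler_wsqrtr // lerDl sqr_ge0.
have imM : cvgn (series im).
  refine (@cvgn_series_real _ M _) => n; apply: le_trans (xM n).
  apply: ler_sum => k _; rewrite /re /im; case: (x k) => s t /=.
  by rewrite -sqrtr_sqr ler_wsqrtr // lerDr sqr_ge0.
have -> : series x = (fun n => real_complex R (series re n) : C)
   + ('i%C : C) *: (fun n => real_complex R (series im n) : C).
  apply/funext => n; rewrite !seriesEnat /= fctE.
  rewrite -[('i%C *: _) n]/(('i%C : C) * real_complex R (\sum_(0 <= k < n) im k)).
  rewrite !rmorph_sum /= big_distrr -big_split /=.
  by apply: eq_bigr => k _; exact: complexE.
by apply: is_cvgD; last apply: is_cvgZr; exact: cvgn_real_complex.
Qed.

(** In the uses below [f] is [Posz] or [Negz], giving the two halves of [sumZ]; injectivity keeps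
    the initial segments duplicate-free, as [ell1P] demands. *)
Lemma ell1_cvgn_series u (f : nat -> int) : injective f -> ell1 u ->
  cvgn (series (u \o f)).
Proof.
move=> fI /ell1P[M uM]; apply: (@cvgn_series_complex _ M) => n.
rewrite -(big_map f predT (fun i => normc (u i))).
by apply: uM; rewrite map_inj_uniq ?iota_uniq.
Qed.

Lemma Posz_inj : injective Posz. Proof. by move=> m n []. Qed.
Lemma Negz_inj : injective Negz. Proof. by move=> m n []. Qed.

Lemma sumZD u v : ell1 u -> ell1 v ->
  sumZ (fun n => u n + v n) = sumZ u + sumZ v.
Proof.
move=> u1 v1; rewrite /sumZ.
have h f : injective f -> limn (series (fun k : nat => u (f k) + v (f k))) =
    limn (series (fun k => u (f k))) + limn (series (fun k => v (f k))).
  by move=> fI; apply: lim_seriesD; apply: ell1_cvgn_series.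
by rewrite (h _ Posz_inj) (h _ Negz_inj); ring.
Qed.

Lemma sumZZ (c : C) u : ell1 u -> sumZ (fun n => c * u n) = c * sumZ u.
Proof.
move=> u1; rewrite /sumZ.
have h f : injective f -> limn (series (fun k : nat => c * u (f k))) =
    c * limn (series (fun k => u (f k))).
  by move=> fI; apply: lim_seriesZ; apply: ell1_cvgn_series.
by rewrite (h _ Posz_inj) (h _ Negz_inj); ring.
Qed.

Lemma sumZ_delta m : sumZ (delta C m) = 1.
Proof.
rewrite -[RHS](innerZ_delta m (fun=> 1)); congr sumZ; apply/funext => n.
by rewrite /delta rmorph_nat mulr1.
Qed.

(** Turns the effect of a finite perturbation on an infinite sum into a finite sum. The sites are
    corrected one at a time, each by adding a multiple of a [delta]. *)
Lemma sumZ_finite_change (r : seq int) u v : uniq r -> ell1 u ->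
  (forall n, n \notin r -> v n = u n) ->
  ell1 v /\ sumZ v = sumZ u + \sum_(n <- r) (v n - u n).
Proof.
elim: r u => [|m r IH] u /=.
  move=> _ u1 uv; rewrite big_nil addr0.
  by rewrite (_ : v = u) //; apply/funext => n; exact: uv.
move=> /andP[mr ur] u1 uv.
pose w n := u n + (v m - u m) * delta C m n.
have d1 := ell1Z (v m - u m) (ell1_delta m).
have wE n : n != m -> w n = u n.
  by move=> nm; rewrite /w /delta (negbTE nm) mulr0 addr0.
have [|v1 ->] := IH w ur (ell1D u1 d1).
  move=> n nr; have [->|nm] := eqVneq n m.
    by rewrite /w /delta eqxx mulr1 addrC subrK.
  by rewrite wE // uv // inE negb_or nm.
split => //; rewrite big_cons sumZD // sumZZ ?sumZ_delta ?mulr1; last exact: ell1_delta.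
rewrite -addrA; congr (_ + (_ + _)); apply: eq_big_seq => n nr.
by rewrite wE //; apply: contraNneq mr => <-.
Qed.

Lemma ell1_cvg0 u : ell1 u -> u n @[n --> inftyZ] --> (0 : C).
Proof.
move=> u1; apply/cvgrPdist_lt => e e0.
have h f : injective f -> \forall n \near \oo, `|0 - u (f n)| < e.
  move=> fI; have /cvg_series_cvg_0 := ell1_cvgn_series fI u1.
  by move=> /cvgrPdist_lt; apply.
have [N _ HN] := h _ Posz_inj; have [M _ HM] := h _ Negz_inj.
(* The successor accounts for [Negz n] having absolute value n + 1. *)
exists (maxn N M).+1 => -[n|n] nNM; [apply: HN|apply: HM]; move: nNM => /=; lia.
Qed.

End Ell1.

(** * Asymptotics of the Toda coefficients *)

Section Gauge.
Variable R : realType.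
Local Notation C := (Cx R).
Local Notation normc := (@ComplexField.Normc.normc R).
Implicit Types (a b c : int -> C).

(* For c = a^2, this is L conjugated by a sequence rho with
   rho(n + 1) = a(n) rho(n). Unlike a itself, a^2 is asymptotically constant. *)
Definition gauged_jacobi c b (u : int -> C) : int -> C :=
  fun n => c n * u (n + 1) + u (n - 1) + b n * u n.

(** The recursion is solved from rho(0) = 1, multiplying by [a] to the right and dividing by [a] to
    the left. *)
Lemma gauge_exists a : (forall n, a n != 0) ->
  exists rho : int -> C, forall n, rho n != 0 /\ rho (n + 1) = a n * rho n.
Proof.
move=> a0.
exists (fun n => match n with Posz k => \prod_(i < k) a i
                            | Negz k => (\prod_(i < k.+1) a (Negz i))^-1 end).
case=> k; split.
- by apply/prodf_neq0 => i _.
- by rewrite -PoszD addn1 big_ord_recr mulrC.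
- by rewrite invr_eq0; apply/prodf_neq0 => i _.
- case: k => [|k].
    by rewrite big_ord1 /= big_ord0 divff.
  have -> : Negz k.+1 + 1 = Negz k by lia.
  rewrite [in RHS]big_ord_recr /= invfM mulrCA divff ?mulr1 //.
Qed.

(** Conjugation by the diagonal [rho] scales the (k, n) entry by rho(k) / rho(n), which is 1 on the
    diagonal. *)
Lemma fhat_gauged a b l n : (forall n, a n != 0) ->
  fhat a b l n = iter l (gauged_jacobi (fun n => a n ^+ 2) b) (delta C n) n.
Proof.
move=> a0; have [rho rhoP] := gauge_exists a0.
suff H j k : iter j (jacobi a b) (delta C n) k * rho n =
    rho k * iter j (gauged_jacobi (fun n => a n ^+ 2) b) (delta C n) k.
  apply: (mulIf (rhoP n).1); rewrite /fhat innerZ_delta H; exact: mulrC.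
elim: j k => [|j IH] k.
  by rewrite /= /delta; case: eqP => [->|_]; rewrite ?mulr0 ?mul0r ?mulr1 ?mul1r.
rewrite !iterS /jacobi /shiftZ /gauged_jacobi !mulrDl -!mulrA !IH.
rewrite (rhoP k).2 -{2}(subrK 1 k) (mulrA (a (k - 1))).
by rewrite -(rhoP (k - 1)).2 subrK; ring.
Qed.

(** The free case a^2 = 1/4, b = 0. By translation invariance the entry (n + s, n) depends on s
    only, so column 0 represents all columns. *)
Definition flat_limit (j : nat) (s : int) : C :=
  iter j (gauged_jacobi (fun=> 4^-1) (fun=> 0)) (delta C 0) s.

Lemma ell1_shifted_const_bounded (u : int -> C) (d : C) :
  ell1 (fun n => u n - d) -> exists M, forall n, normc (u n) <= M.
Proof.
move=> /ell1_bounded[M uM]; exists (M + normc d) => n.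
rewrite -lecR rmorphD /= -!normcE_norm -[u n](subrK d).
apply: le_trans (ler_normD _ _) _; rewrite lerD2r.
by rewrite normcE_norm lecR.
Qed.

(** All diagonals s are treated together, since one application of the operator couples s to s + 1
    and s - 1. *)
Lemma ell1_gauged a b j s :
  ell1 (fun n => a n ^+ 2 - 4^-1) -> ell1 b ->
  ell1 (fun n => iter j (gauged_jacobi (fun n => a n ^+ 2) b) (delta C n) (n + s)
                 - flat_limit j s).
Proof.
move=> a1 b1; elim: j s => [|j IH] s.
  (* Both deltas agree, so the sequence is 0; as a multiple of [b] it inherits summability. *)
  rewrite (_ : (fun _ => _) = (fun n => 0 * b n)); first exact: ell1Z.
  apply/funext => n; rewrite mul0r /flat_limit /= /delta.
  by rewrite (_ : (n + s == n) = (s == 0)) ?subrr //; lia.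
pose u t n := iter j (gauged_jacobi (fun n => a n ^+ 2) b) (delta C n) (n + t).
have [M uM] := ell1_shifted_const_bounded (IH (s + 1)).
have [N uN] := ell1_shifted_const_bounded (IH s).
rewrite (_ : (fun _ => _) = (fun n =>
   (* Products are compared through c u - c' u' = (c - c') u + c' (u - u'): a summable factor times
      a bounded one, plus a constant multiple of a summable sequence. *)
   u (s + 1) n * shiftZ s (fun n => a n ^+ 2 - 4^-1) n +
   4^-1 * (u (s + 1) n - flat_limit j (s + 1)) +
   (u (s - 1) n - flat_limit j (s - 1)) + u s n * shiftZ s b n)).
  apply: ell1D; last by apply: (ell1M uN); exact: ell1_shift.
  apply: ell1D; last exact: IH.
  apply: ell1D; last by apply: ell1Z; exact: IH.
  by apply: (ell1M uM); exact: ell1_shift.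
apply/funext => n; rewrite /flat_limit !iterS /gauged_jacobi /u /shiftZ !addrA.
by ring.
Qed.

Lemma ell1_fhat a b l : toda_data a b ->
  ell1 (fun n => fhat a b l n - flat_limit l 0).
Proof.
case=> _ _ a0 a1 b1; have := ell1_gauged l 0 a1 b1.
by congr ell1; apply/funext => n; rewrite addr0 fhat_gauged.
Qed.

Lemma cvg_fhat a b l : toda_data a b ->
  fhat a b l @ inftyZ --> flat_limit l 0.
Proof.
move=> ab; have /cvgrPdist_lt H := ell1_cvg0 (ell1_fhat l ab).
apply/cvgrPdist_lt => e /H; apply: filterS => n /=.
by rewrite sub0r opprB.
Qed.

(** The right side is free of [a] and [b], as the additive constant in [has_density] has to be. *)
Lemma lambdaE a b l : toda_data a b -> lambda a b l = flat_limit l 0.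
Proof.
by move=> ab; apply: cvg_lim; [exact: norm_hausdorff | exact: cvg_fhat].
Qed.

End Gauge.

(** * Variational derivatives of the Toda coefficients *)

Section JacobiKernel.
Variables (A : comNzRingType) (a b : int -> A).
Local Notation L := (jacobi a b).

(** The ring is general because the kernel identities serve both complex sequences and difference
    polynomials. *)
Lemma iter_jacobi_lincomb (I : Type) (r : seq I) (c : I -> A)
    (f : I -> int -> A) j n :
  iter j L (fun k => \sum_(i <- r) c i * f i k) n =
  \sum_(i <- r) c i * iter j L (f i) n.
Proof.
elim: j n => [//|j IH] n; rewrite iterS /jacobi /shiftZ !IH !big_distrr -!big_split.
by apply: eq_bigr => i _ /=; rewrite /jacobi /shiftZ; ring.
Qed.

Lemma delta_expand (r : seq int) (u : int -> A) : uniq r ->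
  (forall k, k \notin r -> u k = 0) ->
  u = fun k => \sum_(i <- r) u i * delta A i k.
Proof.
move=> ur u0; apply/funext => k; case: (boolP (k \in r)) => kr.
  rewrite (bigD1_seq k) //= /delta eqxx mulr1 big1 ?addr0 // => i ik.
  by rewrite eq_sym (negbTE ik) mulr0.
rewrite u0 // big1_seq // => i /andP[_ ir].
by rewrite /delta (_ : (k == i) = false) ?mulr0 //; apply: contraNF kr => /eqP->.
Qed.

(** The matrix product of L^j and L^i; [r] contains the support of L^i u, which makes the sum over
    intermediate sites finite. *)
Lemma iter_jacobi_comp (r : seq int) (u : int -> A) i j n : uniq r ->
  (forall k, k \notin r -> iter i L u k = 0) ->
  iter (j + i) L u n = \sum_(k <- r) iter i L u k * iter j L (delta A k) n.
Proof.
by move=> ur u0; rewrite iterD [in LHS](delta_expand ur u0) iter_jacobi_lincomb.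
Qed.

(** L is a symmetric matrix, a(m) coupling m and m + 1 both ways. The induction peels a factor off
    the right of L^(j+1) on one side and off the left on the other. *)
Lemma iter_jacobi_sym j n m :
  iter j L (delta A m) n = iter j L (delta A n) m.
Proof.
elim: j n m => [|j IH] n m; first by rewrite /= /delta eq_sym.
rewrite -[in LHS]addn1 (@iter_jacobi_comp [:: m + 1; m - 1; m]).
- rewrite !big_cons big_nil iterS /= !(IH n) /jacobi /shiftZ /delta.
  rewrite ?addrK ?subrK !eqxx.
  have -> : (m + 1 + 1 == m) = false by lia.
  have -> : (m + 1 == m) = false by lia.
  have -> : (m - 1 == m) = false by lia.
  have -> : (m - 1 - 1 == m) = false by lia.
  by rewrite /= !mulr0n !mulr1n; ring.
- by rewrite /= !inE; lia.
- move=> k; rewrite !inE /= /jacobi /shiftZ /delta => /norP[k1 /norP[k2 k3]].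
  have -> : (k + 1 == m) = false by lia.
  have -> : (k - 1 == m) = false by lia.
  by rewrite (negbTE k3) !mulr0 !addr0.
Qed.

Section Derivation.
Variable d : A -> A.
Hypothesis dD : {morph d : x y / x + y}.
Hypothesis dM : forall x y, d (x * y) = d x * y + x * d y.

Lemma derivation_natr (n : nat) : d n%:R = 0.
Proof.
have d0 : d 0 = 0 by apply: (addrI (d 0)); rewrite -dD !addr0.
have d1 : d 1 = 0.
  by apply: (addrI (d 1)); rewrite addr0 -[in RHS](mulr1 1) dM mulr1 mul1r.
by elim: n => [//|n IH]; rewrite -addn1 natrD dD IH d1 addr0.
Qed.

(** Leibniz rule for a power: d(L^l) is the sum of L^i (dL) L^(l-1-i), where dL has coefficients d a
    and d b. *)
Lemma derivation_iter_jacobi l n' n :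
  d (iter l L (delta A n') n) =
  \sum_(i < l) iter i L
    (jacobi (d \o a) (d \o b) (iter (l - i.+1) L (delta A n'))) n.
Proof.
elim: l n => [|l IH] n; first by rewrite big_ord0 /= derivation_natr.
rewrite iterS big_ord_recl /= subn1 /=.
rewrite {1}/jacobi !dD !dM /shiftZ !IH !big_distrr /=.
under [in RHS]eq_bigr do rewrite subSS.
by rewrite {4}/jacobi /shiftZ !big_split /= -!big_distrr /= /jacobi /shiftZ /=; ring.
Qed.

(** A variation at the single site m: the only possibly nonzero entries of dL are [be] at (m, m) and
    [al] at (m, m + 1) and (m + 1, m). Symmetry of L turns both outer factors into entries of the
    column of [delta A n]. *)
Lemma derivation_iter_jacobi_delta (al be : A) m l n :
  d \o a = (fun k => al * delta A m k) -> d \o b = (fun k => be * delta A m k) ->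
  let M j k := iter j L (delta A n) k in
  d (iter l L (delta A n) n) =
  \sum_(i < l) (al * (M i m * M (l - i.+1)%N (m + 1) +
                      M i (m + 1) * M (l - i.+1)%N m) +
                be * (M i m * M (l - i.+1)%N m)).
Proof.
move=> da db M; rewrite derivation_iter_jacobi; apply: eq_bigr => i _.
rewrite da db.
set u := iter (l - i.+1)%N _ _.
(* The values of dL u at m and m + 1, outside of which it vanishes. *)
pose c (x : int) : A := if x == m then al * u (m + 1) + be * u m else al * u m.
have -> : jacobi (fun k => al * delta A m k) (fun k => be * delta A m k) u =
  (fun k => \sum_(x <- [:: m; m + 1]) c x * delta A x k).
  apply/funext => k; rewrite !big_cons big_nil /c /jacobi /shiftZ /delta.
  rewrite eqxx (_ : (m + 1 == m) = false); last by lia.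
  have [->|km] := eqVneq k m.
    have -> : (m - 1 == m) = false by lia.
    have -> : (m == m + 1) = false by lia.
    by rewrite /= !mulr0n !mulr1n; ring.
  have [->|km1] := eqVneq k (m + 1).
    by rewrite addrK eqxx /= !mulr0n !mulr1n; ring.
  have -> : (k - 1 == m) = false by lia.
  by rewrite /= !mulr0n; ring.
rewrite iter_jacobi_lincomb.
rewrite !big_cons big_nil /c eqxx (_ : (m + 1 == m) = false); last by lia.
rewrite !(iter_jacobi_sym _ n) -!/(M _ _) -/u.
by rewrite addr0 /M -/u; ring.
Qed.

End Derivation.
End JacobiKernel.

(** * Variational derivatives of [fpoly] as matrix entries of powers of L *)

Section FpolyVariation.
Variable R : realType.
Local Notation C := (Cx R).
Implicit Types (a b : int -> C).

Lemma jacobi_supp0 a b (n k : int) (j : nat) :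
  (j < `|(k - n)%R|)%N -> iter j (jacobi a b) (delta C n) k = 0.
Proof. by move=> jk; rewrite -(jacobi_supp a b n jk) addrC subrK. Qed.

(** Extends the computation behind [fpolyE] to off-diagonal entries. The cut-off of the coefficients
    at distance l is invisible: L^j spreads [delta] only to distance j, so a missing coefficient
    always multiplies 0. *)
Lemma meval_jacobi_gen (l : nat) a b n j s : (j <= l)%N ->
  meval (@jet R l a b n)
    (iter j (jacobi (gen_a R l) (gen_b R l)) (delta (dpoly R l) 0) s) =
  iter j (jacobi a b) (delta C n) (n + s).
Proof.
elim: j s => [|j IH] s jl.
  by rewrite /= /delta rmorph_nat; congr (_%:R); congr nat_of_bool; lia.
rewrite !iterS /jacobi /shiftZ !rmorphD !rmorphM /= !IH ?(ltnW jl) //.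
rewrite !dpeval_gen_a !dpeval_gen_b -!addrA.
congr (_ + (_ + _)); case: ifP => // sl;
  by rewrite jacobi_supp ?mulr0 //; lia.
Qed.

(** Puts the partial derivatives in the form asked by [derivation_iter_jacobi_delta], with m =
    [offset i]. *)
Lemma mderiv_gen_a l (i : 'I_l.*2.+1) s :
  mderiv (avar i) (gen_a R l s) = delta (dpoly R l) (offset i) s /\
  mderiv (bvar i) (gen_a R l s) = 0.
Proof.
rewrite /gen_a !raddf_sum /=; split; last first.
  rewrite big1 // => j _; rewrite mderivX mnm1E.
  by rewrite (_ : (_ == _) = false) ?scale0r //; apply/eqP => /eqP; rewrite eq_lrshift.
rewrite big_mkcond (bigD1 i) //= big1 ?addr0; last first.
  move=> j ji; rewrite mderivX mnm1E.
  by rewrite (inj_eq (@lshift_inj _ _)) (negbTE ji) scale0r if_same.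
rewrite /delta eq_sym; case: eqP => // _.
rewrite mderivX mnm1E eqxx scale1r -mpolyX0; congr mpolyX.
by apply/mnmP => j; rewrite mnmBE subnn mnm0E.
Qed.

Lemma mderiv_gen_b l (i : 'I_l.*2.+1) s :
  mderiv (avar i) (gen_b R l s) = 0 /\
  mderiv (bvar i) (gen_b R l s) = delta (dpoly R l) (offset i) s.
Proof.
rewrite /gen_b !raddf_sum /=; split.
  rewrite big1 // => j _; rewrite mderivX mnm1E.
  by rewrite (_ : (_ == _) = false) ?scale0r //; apply/eqP => /eqP; rewrite eq_rlshift.
rewrite big_mkcond (bigD1 i) //= big1 ?addr0; last first.
  move=> j ji; rewrite mderivX mnm1E.
  by rewrite (inj_eq (@rshift_inj _ _)) (negbTE ji) scale0r if_same.
rewrite /delta eq_sym; case: eqP => // _.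
rewrite mderivX mnm1E eqxx scale1r -mpolyX0; congr mpolyX.
by apply/mnmP => j; rewrite mnmBE subnn mnm0E.
Qed.

(** The window is the interval [n - l, n + l]; the strict bound j < l leaves room to start at a
    neighbour of n. *)
Lemma offset_window l (m : int) (j : nat) a b n : (j < l)%N ->
  (`|(m - n)%R| <= 1)%N -> forall k, k \notin [seq n - offset i | i : 'I_l.*2.+1] ->
  iter j (jacobi a b) (delta C m) k = 0.
Proof.
move=> jl mn k kr; apply: jacobi_supp0; rewrite ltnNge; apply: contra kr => kj.
have lt : (`|(n - k + l%:Z)%R| < l.*2.+1)%N by lia.
by apply/mapP; exists (Ordinal lt); rewrite ?mem_enum // /offset /=; lia.
Qed.

Lemma uniq_window l (n : int) : uniq [seq n - offset i | i : 'I_l.*2.+1].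
Proof.
rewrite map_inj_uniq ?enum_uniq // => i j; rewrite /offset => ij.
by apply/val_inj => /=; lia.
Qed.

(* Cyclicity of the trace; the window contains the support of L^i delta_n'. *)
Lemma sum_window_kernel l a b n n' i j : (i < l)%N -> (`|(n' - n)%R| <= 1)%N ->
  \sum_(s < l.*2.+1) iter i (jacobi a b) (delta C (n - offset s)) n' *
     iter j (jacobi a b) (delta C (n - offset s)) n =
  iter (j + i) (jacobi a b) (delta C n') n.
Proof.
move=> il nn'.
rewrite (iter_jacobi_comp (r := [seq n - offset s | s : 'I_l.*2.+1])).
- rewrite big_map big_enum /=; apply: eq_bigr => s _.
  by rewrite iter_jacobi_sym.
- exact: uniq_window.
- exact: offset_window.
Qed.

(** The i-th summand is the derivative of fhat at n - [offset i] with respect to b(n), so the sum is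
    that of the trace. Each of the l + 1 Leibniz terms contributes L^l(n, n) by cyclicity. *)
Lemma vard_b_fpoly l a b n :
  vard_b (fpoly R l.+1) a b n = l.+1%:R * fhat a b l n.
Proof.
rewrite /fhat innerZ_delta /vard_b /shiftZ /dpeval /fpoly.
set M := fun j m k => iter j (jacobi a b) (delta C m) k.
rewrite (eq_bigr (fun i : 'I_l.+1.*2.+1 => \sum_(j < l.+1)
   M j (n - offset i) n * M (l - j)%N (n - offset i) n)) => [|i _].
  rewrite exchange_big /= (eq_bigr (fun=> M l n n)) => [|j _].
    by rewrite sumr_const card_ord [RHS]mulr_natl.
  rewrite (sum_window_kernel (l := l.+1)) ?ltn_ord //; last by rewrite subrr.
  by rewrite /M subnK // -ltnS.
have da : mderiv (bvar i) \o gen_a R l.+1 = fun k => 0 * delta _ (offset i) k.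
  by apply/funext => k; rewrite /= (mderiv_gen_a i k).2 mul0r.
have db : mderiv (bvar i) \o gen_b R l.+1 = fun k => 1 * delta _ (offset i) k.
  by apply/funext => k; rewrite /= (mderiv_gen_b i k).2 mul1r.
rewrite (derivation_iter_jacobi_delta (mderivD (bvar i)) (mderivM (bvar i)) l.+1 0 da db).
rewrite rmorph_sum /=; apply: eq_bigr => j _; have jl := ltn_ord j.
rewrite mul0r add0r mul1r rmorphM /= !meval_jacobi_gen ?subSS; try lia.
by rewrite subrK.
Qed.

(** As for b, but each Leibniz term has two parts, from the entries (n, n + 1) and (n + 1, n) of dL;
    by symmetry they are equal, whence the factor 2. *)
Lemma vard_a_fpoly l a b n :
  vard_a (fpoly R l.+1) a b n =
  l.+1%:R * (2 * iter l (jacobi a b) (delta C n) (n + 1)).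
Proof.
rewrite /vard_a /shiftZ /dpeval /fpoly.
set M := fun j m k => iter j (jacobi a b) (delta C m) k.
rewrite (eq_bigr (fun i : 'I_l.+1.*2.+1 => \sum_(j < l.+1)
   (M (l - j)%N (n - offset i) (n + 1) * M j (n - offset i) n + 
    M j (n - offset i) (n + 1) * M (l - j)%N (n - offset i) n))) => [|i _].
  rewrite exchange_big /= (eq_bigr (fun=> 2 * M l n (n + 1))) => [|j _]; last first.
    have jl := ltn_ord j.
    rewrite big_split /= !(sum_window_kernel (l := l.+1)); try lia.
    have -> : (j + (l - j) = l)%N by lia.
    have -> : (l - j + j = l)%N by lia.
    by rewrite iter_jacobi_sym mulr_natl mulr2n.
  by rewrite sumr_const card_ord [RHS]mulr_natl.
have da : mderiv (avar i) \o gen_a R l.+1 = fun k => 1 * delta _ (offset i) k.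
  by apply/funext => k; rewrite /= (mderiv_gen_a i k).1 mul1r.
have db : mderiv (avar i) \o gen_b R l.+1 = fun k => 0 * delta _ (offset i) k.
  by apply/funext => k; rewrite /= (mderiv_gen_b i k).1 mul0r.
rewrite (derivation_iter_jacobi_delta (mderivD (avar i)) (mderivM (avar i)) l.+1 0 da db).
rewrite rmorph_sum /=; apply: eq_bigr => j _; have jl := ltn_ord j.
rewrite mul1r mul0r addr0 subSS rmorphD 2!rmorphM /=.
rewrite !meval_jacobi_gen; try lia.
have -> : n - offset i + offset i = n by ring.
have -> : n - offset i + (offset i + 1) = n + 1 by ring.
by congr (_ + _); rewrite mulrC.
Qed.

End FpolyVariation.

(** * Uniqueness of the gradient *)

Section DirectionalDerivative.
Variable R : realType.
Local Notation C := (Cx R).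
Implicit Types (a b : int -> C).

(** P is F along the line v + e w, and its derivative at 0 is the chain rule. The property holds for
    constants and variables and passes to sums and products. *)
Lemma directional_poly (N : nat) (v w : 'I_N -> C) (F : mpoly N C) :
  exists P : {poly C},
    (forall e, P.[e] = meval (fun j => v j + e * w j) F) /\
    P^`().[0] = \sum_(j < N) w j * meval v (mderiv j F).
Proof.
pose K F := exists P : {poly C},
    (forall e, P.[e] = meval (fun j => v j + e * w j) F) /\
    P^`().[0] = \sum_(j < N) w j * meval v (mderiv j F).
have evalv G : meval (fun j => v j + 0 * w j) G = meval v G.
  by apply: meval_eq => j; rewrite mul0r addr0.
have KC c : K (mpolyC N c).
  exists c%:P; split => [e|]; first by rewrite hornerC mevalC.
  by rewrite derivC horner0 big1 // => j _; rewrite mderivC meval0 mulr0.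
have KD G H : K G -> K H -> K (G + H).
  move=> [P [PG P'G]] [Q [QH Q'H]]; exists (P + Q); split => [e|].
    by rewrite hornerD PG QH mevalD.
  rewrite derivD hornerD P'G Q'H -big_split /=; apply: eq_bigr => j _.
  by rewrite mderivD mevalD mulrDr.
have KM G H : K G -> K H -> K (G * H).
  move=> [P [PG P'G]] [Q [QH Q'H]]; exists (P * Q); split => [e|].
    by rewrite hornerM PG QH mevalM.
  rewrite derivM hornerD !hornerM P'G Q'H PG QH !evalv big_distrl big_distrr.
  rewrite -big_split /=; apply: eq_bigr => j _.
  by rewrite mderivM mevalD !mevalM; ring.
have KX i : K (mpolyX C (mnm1 i)).
  exists ((v i)%:P + w i *: 'X); split => [e|].
    by rewrite mevalXU hornerD hornerC hornerZ hornerX mulrC.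
  rewrite derivD derivC derivZ derivX add0r hornerZ hornerC (bigD1 i) //=.
  rewrite big1 => [|j ji]; rewrite mderivX mnm1E.
    rewrite eqxx mevalZ mul1r addr0.
    have -> : mnm_sub (mnm1 i) (mnm1 i) = mnm0 by apply/mnmP => j; rewrite mnmBE subnn mnm0E.
    by rewrite mpolyX0 meval1.
  by rewrite eq_sym (negbTE ji) scale0r meval0 mulr0.
elim/mpolyind: F => [|c m p _ _ Kp]; first by rewrite -mpolyC0; exact: KC.
apply: (KD) Kp; rewrite -mul_mpolyC; apply: (KM); first exact: KC.
rewrite mpolyXE_id; apply: (big_ind K) => [||i _]; first by rewrite -mpolyC1; exact: KC.
  exact: KM.
elim: (m i) => [|n IH]; first by rewrite expr0 -mpolyC1; exact: KC.
by rewrite exprS; exact: KM (KX i) IH.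
Qed.

Definition perturb (m : int) (c : C) (u : int -> C) : int -> C :=
  fun n => u n + c * delta C m n.

Lemma perturb0 m u : perturb m 0 u = u.
Proof. by apply/funext => n; rewrite /perturb mul0r addr0. Qed.

Lemma perturb_neq m c u n : n != m -> perturb m c u n = u n.
Proof. by move=> nm; rewrite /perturb /delta (negbTE nm) mulr0 addr0. Qed.

(** The density at n reads only the sites n + [offset i], and m is not among them off the window. *)
Lemma dpeval_perturb k (F : dpoly R k) a b m c d n :
  n \notin [seq m - offset i | i : 'I_k.*2.+1] ->
  dpeval F (perturb m c a) (perturb m d b) n = dpeval F a b n.
Proof.
move=> nr; apply: meval_eq => j; rewrite /jet /shiftZ.
have h (i : 'I_k.*2.+1) : n + offset i != m.
  by apply: contra nr => /eqP<-; apply/mapP; exists i; rewrite ?mem_enum ?addrK.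
by case: fintype.split => i; rewrite perturb_neq.
Qed.

(** Seen from n = m - [offset i], perturbing the site m moves only the variables of offset i.
    Summing these partial derivatives over the window gives the variational derivatives at m. *)
Lemma dpeval_window_poly k (F : dpoly R k) a b m (al be : C) :
  exists P : {poly C},
    (forall e, P.[e] = \sum_(n <- [seq m - offset i | i : 'I_k.*2.+1])
       dpeval F (perturb m (e * al) a) (perturb m (e * be) b) n) /\
    P^`().[0] = al * vard_a F a b m + be * vard_b F a b m.
Proof.
pose w (i : 'I_k.*2.+1) (j : 'I_(k.*2.+1 + k.*2.+1)) : C :=
  match fintype.split j with
  | inl i' => al * (i' == i)%:R | inr i' => be * (i' == i)%:R end.
have [P HP] := choice (fun i => directional_poly (@jet R k a b (m - offset i)) (w i) F).
exists (\sum_i P i); split => [e|].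
  rewrite big_map big_enum horner_sum; apply: eq_bigr => i _.
  rewrite (HP i).1; apply: meval_eq => j; rewrite /jet /w /shiftZ /perturb /delta.
  have h (i' : 'I_k.*2.+1) : (m - offset i + offset i' == m) = (i' == i).
    by rewrite -[in RHS]val_eqE /offset /=; lia.
  by case: fintype.split => i' /=; rewrite h; ring.
rewrite raddf_sum horner_sum /= /vard_a /vard_b !big_distrr -big_split /=.
apply: eq_bigr => i _; rewrite (HP i).2 big_split_ord /=.
rewrite (bigD1 i) //= [X in _ + X + _]big1 => [|j ji]; last first.
  by rewrite /w (unsplitK (inl j)) (negbTE ji) mulr0 mul0r.
rewrite [X in _ + X](bigD1 i) //= [X in _ + (_ + X)]big1 => [|j ji]; last first.
  by rewrite /w (unsplitK (inr j)) (negbTE ji) mulr0 mul0r.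
by rewrite /w (unsplitK (inl i)) (unsplitK (inr i)) eqxx !mulr1 !addr0.
Qed.

Lemma horner_eq0_poly (p : {poly C}) : (forall x, p.[x] = 0) -> p = 0.
Proof.
move=> p0; apply/eqP/negPn/negP => pn0.
(* In characteristic 0 these are [size p] distinct roots, one more than the degree allows. *)
pose rs : seq C := [seq n%:R | n <- iota 0 (size p)].
suff : (size rs < size p)%N by rewrite size_map size_iota ltnn.
apply: max_poly_roots => //.
  by apply/allP => x _; rewrite /root p0.
by rewrite map_inj_uniq ?iota_uniq // => i j /eqP; rewrite eqr_nat => /eqP.
Qed.

End DirectionalDerivative.

(** * Independence of the gradient from the density *)

Section GradientUniqueness.
Variable R : realType.
Local Notation C := (Cx R).
Implicit Types (a b : int -> C).

Lemma toda_data_perturb m (c d : C) a b : toda_data a b -> a m + c != 0 ->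
  toda_data (perturb m c a) (perturb m d b).
Proof.
case=> [[M aM] [N bN] a0 a1 b1] am0.
have bdd (u : int -> C) K x : (forall n, `|u n| <= K) -> bounded_seqZ (perturb m x u).
  move=> uK; exists (K + `|x|) => n; apply: le_trans (ler_normD _ _) _.
  apply: lerD => //; rewrite /delta; case: eqP => _; rewrite ?mulr1 // mulr0.
  by rewrite normr0.
split; [exact: bdd | exact: bdd | | |].
- move=> n; have [->|nm] := eqVneq n m; last by rewrite perturb_neq.
  by rewrite /perturb /delta eqxx mulr1.
- apply: (sumZ_finite_change (r := [:: m]) _ a1 _).1 => // n.
  by rewrite inE => nm; rewrite perturb_neq.
- apply: (sumZ_finite_change (r := [:: m]) _ b1 _).1 => // n.
  by rewrite inE => nm; rewrite perturb_neq.
Qed.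

(** In the difference of the two infinite sums the constant c and all sites off the window cancel,
    leaving a finite sum that is polynomial in e. *)
Lemma density_perturb_poly (I : (int -> C) -> (int -> C) -> C)
    k (F : dpoly R k) a b m (al be : C) :
  has_density I F -> toda_data a b ->
  exists P : {poly C},
    (forall e, a m + e * al != 0 ->
       P.[e] - P.[0] = I (perturb m (e * al) a) (perturb m (e * be) b) - I a b) /\
    P^`().[0] = al * vard_a F a b m + be * vard_b F a b m.
Proof.
move=> [c Fc] ab; have [P [PE P'E]] := dpeval_window_poly F a b m al be.
exists P; split => // e ae.
have [F1 ->] := Fc _ _ ab.
have [_ ->] := Fc _ _ (toda_data_perturb (e * be) ab ae).
have [|_ ->] := sumZ_finite_change (v := fun n =>
  dpeval F (perturb m (e * al) a) (perturb m (e * be) b) n - c) (uniq_window k m) F1.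
  by move=> n nr; rewrite dpeval_perturb.
rewrite [RHS]addrC addKr !PE !mul0r !perturb0 -sumrB; apply: eq_bigr => n _.
by ring.
Qed.

(* Perturbing a and b at the single site m changes both functionals by
   polynomials in the size of the perturbation. These agree for all admissible
   sizes, hence everywhere, and so do their derivatives at 0. *)
Lemma gradient_unique (I : (int -> C) -> (int -> C) -> C)
    k (F : dpoly R k) k' (G : dpoly R k') a b m (al be : C) :
  has_density I F -> has_density I G -> toda_data a b ->
  al * vard_a F a b m + be * vard_b F a b m =
  al * vard_a G a b m + be * vard_b G a b m.
Proof.
move=> IF IG ab.
have [P [PI <-]] := density_perturb_poly m al be IF ab.
have [Q [QI <-]] := density_perturb_poly m al be IG ab.
pose S := P - P.[0]%:P - (Q - Q.[0]%:P).
have a0 : a m != 0 by case: ab.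
(* The linear factor vanishes exactly at the inadmissible sizes, so the product vanishes everywhere;
   the factor itself is nonzero because its value at 0 is a(m). *)
have: S * ((a m)%:P + al *: 'X) = 0.
  apply: horner_eq0_poly => e.
  rewrite hornerM !(hornerD, hornerN, hornerC, hornerZ, hornerX) (mulrC al).
  have [->|ae] := eqVneq (a m + e * al) 0; first exact: mulr0.
  by rewrite PI // QI // subrr mul0r.
move/eqP; rewrite mulf_eq0 => /orP[/eqP S0|/eqP X0]; last first.
  have := congr1 (fun p => p.[0]) X0.
  rewrite hornerD hornerC hornerZ hornerX mulr0 addr0 horner0 => am0.
  by rewrite am0 eqxx in a0.
have := congr1 (fun p => p^`().[0]) S0.
rewrite /S !(derivB, derivC) !subr0 hornerD hornerN horner0.
by move/eqP; rewrite subr_eq0 => /eqP.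
Qed.

Lemma vard_a_unique (I : (int -> C) -> (int -> C) -> C)
    k (F : dpoly R k) k' (G : dpoly R k') a b m :
  has_density I F -> has_density I G -> toda_data a b ->
  vard_a F a b m = vard_a G a b m.
Proof.
move=> IF IG ab; have := gradient_unique m 1 0 IF IG ab.
by rewrite !mul1r !mul0r !addr0.
Qed.

Lemma vard_b_unique (I : (int -> C) -> (int -> C) -> C)
    k (F : dpoly R k) k' (G : dpoly R k') a b m :
  has_density I F -> has_density I G -> toda_data a b ->
  vard_b F a b m = vard_b G a b m.
Proof.
move=> IF IG ab; have := gradient_unique m 0 1 IF IG ab.
by rewrite !mul1r !mul0r !add0r.
Qed.

(** The density F shows that a gradient exists, so the choice made by [xget] is one. It may come
    from another density, which uniqueness reconciles with F on [toda_data]. *)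
Lemma nabla_density (I : (int -> C) -> (int -> C) -> C)
    k (F : dpoly R k) a b :
  has_density I F -> toda_data a b ->
  nabla I a b = (vard_a F a b, vard_b F a b).
Proof.
move=> IF ab; have : is_gradient I (nabla I).
  by apply: (@xgetPex _ _ [set G | is_gradient I G]);
    exists (fun a b => (vard_a F a b, vard_b F a b)); exists k, F.
move=> [k' [G [IG ->]]]; congr (_, _); apply/funext => m.
  exact: vard_a_unique IG IF ab.
exact: vard_b_unique IG IF ab.
Qed.

End GradientUniqueness.

(** * Gradients of the Toda Hamiltonians *)

(** Writing p = l - 1 with l natural covers all p >= -1 and turns p + 1 and p + 2 into l and l +
    1. *)
Lemma has_density_Ihat (R : realType) (l : nat) :
  has_density (Ihat (l%:Z - 1))
    ((l.+1%:R : Cx R)^-1 *: fpoly R l.+1).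
Proof.
have pl : l%:Z - 1 + 2 = l.+1 by lia.
pose c : Cx R := l.+1%:R^-1 * flat_limit R l.+1 0.
exists c => a b ab.
have e : (fun n => dpeval (l.+1%:R^-1 *: fpoly R l.+1) a b n - c) =
    (fun n => l.+1%:R^-1 * (fhat a b l.+1 n - flat_limit R l.+1 0)).
  by apply/funext => n; rewrite /dpeval mevalZ -/(dpeval _ a b n) fpolyE mulrBr.
rewrite e; split; first by apply: ell1Z; exact: ell1_fhat.
by rewrite sumZZ ?/Ihat ?pl ?absz_nat ?lambdaE //; exact: ell1_fhat.
Qed.

Lemma nabla_Ihat (R : realType) (l : nat) (a b : int -> Cx R) : toda_data a b ->
  nabla (Ihat (l%:Z - 1)) a b =
  (fun n => l.+1%:R^-1 * vard_a (fpoly R l.+1) a b n,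
   fun n => l.+1%:R^-1 * vard_b (fpoly R l.+1) a b n).
Proof.
move=> ab; rewrite (nabla_density (has_density_Ihat R l) ab).
congr (_, _); apply/funext => n; rewrite /vard_a /vard_b big_distrr;
  by apply: eq_bigr => i _; rewrite /shiftZ /dpeval mderivZ mevalZ.
Qed.

Lemma vard_a_ghat (R : realType) (l : nat) (a b : int -> Cx R) n : a n != 0 ->
  l.+1%:R^-1 * vard_a (fpoly R l.+1) a b n = - (a n)^-1 * ghat a b l n.
Proof.
move=> an; rewrite vard_a_fpoly mulKf ?pnatr_eq0 // /ghat innerZ_delta.
by field.
Qed.

Lemma vard_b_fhat (R : realType) (l : nat) (a b : int -> Cx R) n :
  l.+1%:R^-1 * vard_b (fpoly R l.+1) a b n = fhat a b l n.
Proof. by rewrite vard_b_fpoly mulKf ?pnatr_eq0. Qed.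

Theorem theorem5p4 (R : realType) (p : int) (hp : -1 <= p) :
  (forall a b : int -> Cx R, toda_data a b ->
     [/\ fhat a b `|p + 2| @ inftyZ --> lambda a b `|p + 2|,
         ell1 (fun n => fhat a b `|p + 2| n - lambda a b `|p + 2|),
         (forall n : int,
            (nabla (Ihat p) a b).1 n
              = (p + 2)%:~R^-1 * vard_a (fpoly R `|p + 2|) a b n /\
            (p + 2)%:~R^-1 * vard_a (fpoly R `|p + 2|) a b n
              = - (a n)^-1 * ghat a b `|p + 1| n) &
         (forall n : int,
            (nabla (Ihat p) a b).2 n
              = (p + 2)%:~R^-1 * vard_b (fpoly R `|p + 2|) a b n /\
            (p + 2)%:~R^-1 * vard_b (fpoly R `|p + 2|) a b n
              = fhat a b `|p + 1| n)]) /\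
  (forall (J : set R) (a b : R -> int -> Cx R),
     open J -> is_interval J ->
     (forall t, J t -> toda_data (a t) (b t)) ->
     (forall t n, J t ->
        time_derivable (a ^~ n) t /\ time_derivable (b ^~ n) t) ->
     forall t, J t -> (toda_eqs p a b t <-> toda_hamiltonian_eqs p a b t)).
Proof.
have [l ->] : exists l : nat, p = l%:Z - 1 by exists `|(p + 1)%R|%N; lia.
have p1 : l%:Z - 1 + 1 = l by lia.
have p2 : l%:Z - 1 + 2 = l.+1 by lia.
rewrite p2 -pmulrn; split.
  rewrite p1 !absz_nat => a b ab; rewrite lambdaE // nabla_Ihat //=.
  have a0 n : a n != 0 by case: ab.
  split; [exact: cvg_fhat | exact: ell1_fhat | |] => n; split => //.
    exact: vard_a_ghat.
  exact: vard_b_fhat.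
move=> J a b _ _ ab _ t Jt.
have a0 n : a t n != 0 by case: (ab t Jt).
rewrite /toda_eqs /toda_hamiltonian_eqs p1 absz_nat nabla_Ihat; last exact: ab.
set f := fhat (a t) (b t) l; set g := ghat (a t) (b t) l.
(* The factor a(m) inside [D2] cancels the 1/a of the gradient, so [D2] yields -g + g^-, while [D1]
   applied to f yields a (f^+ - f). *)
have ga m : - g m = a t m * (l.+1%:R^-1 * vard_a (fpoly R l.+1) (a t) (b t) m).
  by rewrite vard_a_ghat // mulrA mulrN divff // mulN1r.
have -> : (fun n => time_derivative (a ^~ n) t, fun n => time_derivative (b ^~ n) t)
    - Dmx (a t) (fun n => l.+1%:R^-1 * vard_a (fpoly R l.+1) (a t) (b t) n,
                 fun n => l.+1%:R^-1 * vard_b (fpoly R l.+1) (a t) (b t) n) =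
  (fun n => time_derivative (a ^~ n) t - (a t n * f (n + 1) - a t n * f n),
   fun n => time_derivative (b ^~ n) t - (- g n - - g (n - 1))).
  congr (_, _); apply/funext => n; first by rewrite /f -!vard_b_fhat.
  by rewrite !ga.
rewrite /shiftZ; split => [H|H n].
  congr (_, _); apply/funext => n; have [Ha Hb] := H n.
    by rewrite -mulrBr Ha.
  by apply: etrans Hb; ring.
have /= Ha := congr1 (fun q => q.1 n) H; have /= Hb := congr1 (fun q => q.2 n) H.
by rewrite mulrBr Ha; split; [|rewrite -[RHS]Hb; ring].
Qed.
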